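(* Let $\mathcal C_{2n}$ be a balanced weighted oriented cycle on vertices $v_1,\dots,v_{2n}$ with edges $e_1,\dots,e_{2n}$, where $e_i$ is incident with $v_i$ and $v_{i+1}$ for $i=1,\dots,2n$ (with $v_{2n+1}=v_1$), and let $A(\mathcal C_{2n})$ be its incidence matrix, with $v_i$ corresponding to the $i$-th row and $e_i$ to the $i$-th column. Then $I_{\mathcal C_{2n}}$ is generated by the primitive binomial $f_{\mathbf c_{2n}}$, where $$\mathbf c_{2n}=\frac1d\Big((-1)^{i+1}M_{2n-1}(A(\mathcal C_{2n})[1|i])\Big)_{i=1}^{2n}\in\mathbb Z^{2n}$$ and $d=\gcd\big(M_{2n-1}(A(\mathcal C_{2n})[1|i]) : 1\le i\le 2n\big)$.
   Context: $K$ is a field. A weighted oriented graph $D=(V(D),E(D),\mathbf w)$ is a finite graph without loops or parallel edges, each edge being given an orientation ($(x,y)$ denotes an edge from $x$ to $y$), together with a weight function $\mathbf w:V(D)\to\{1,2,\dots\}$. Its incidence matrix $A(D)$ has rows indexed by vertices and columns by edges; the entry in row $x$ and column $e$ is $1$ if $e=(x,y)$ for some $y$, $\mathbf w(x)$ if $e=(y,x)$ for some $y$, and $0$ otherwise. The toric ideal $I_D$ is the kernel of the $K$-algebra homomorphism $K[e: e\in E(D)]\to K[x: x\in V(D)]$ sending $e=(x,y)$ to $x\,y^{\mathbf w(y)}$. A weighted oriented cycle is a weighted oriented graph whose underlying undirected graph is a cycle; an even one is balanced if the determinant of its incidence matrix is $0$. For a matrix $A$, $M_k(A[i_1,\dots|j_1,\dots])$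 denotes the $k\times k$ minor (determinant) obtained from $A$ by deleting rows $i_1,\dots$ and columns $j_1,\dots$. For $\mathbf b\in\mathbb Z^m$, $f_{\mathbf b}=\prod_{b_i>0}e_i^{b_i}-\prod_{b_i<0}e_i^{-b_i}$. A nonzero binomial $\mathbf e^{\mathbf u}-\mathbf e^{\mathbf v}\in I_D$ is primitive if there is no other nonzero binomial $\mathbf e^{\mathbf u'}-\mathbf e^{\mathbf v'}\in I_D$ with $\mathbf e^{\mathbf u'}\mid\mathbf e^{\mathbf u}$ and $\mathbf e^{\mathbf v'}\mid\mathbf e^{\mathbf v}$. *)

(* Defs.v *)
From HB Require Import structures.
From mathcomp Require Import all_boot all_order all_algebra.
From mathcomp Require Import mpoly.

Set Implicit Arguments.
Unset Strict Implicit.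
Unset Printing Implicit Defensive.

Import Order.TTheory GRing.Theory Num.Theory.
Local Open Scope ring_scope.

(* Weighted oriented graphs with vertices v_0, ..., v_(p-1) and edges
   e_0, ..., e_(q-1); the edge e goes from [src e] to [tgt e].  Opposite
   orientations of one undirected edge also count as parallel. *)
Record wograph (p q : nat) := WOGraph {
  src : 'I_q -> 'I_p;
  tgt : 'I_q -> 'I_p;
  wt : 'I_p -> nat;
  src_neq_tgt : forall e, src e != tgt e;
  ends_inj : injective (fun e => [set src e; tgt e]);
  wt_gt0 : forall x, (0 < wt x)%N
}.

Definition incidence_mx p q (D : wograph p q) : 'M[int]_(p, q) :=
  \matrix_(x, e) (if x == src D e then 1
                  else if x == tgt D e then (wt D x)%:Z else 0).

(* The underlying graph is the cycle v_0 v_1 ... v_(m-1), with e_i joining v_i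
   and v_(i+1); [ordS] is the successor modulo m.  Orientation is free. *)
Definition is_cycle m (D : wograph m m) : Prop :=
  (3 <= m)%N /\ forall i : 'I_m, [set src D i; tgt D i] = [set i; ordS i].

(* Only meaningful for even cycles. *)
Definition balanced m (D : wograph m m) : Prop := \det (incidence_mx D) = 0.

Definition edge_images (K : fieldType) p q (D : wograph p q) :
    q.-tuple {mpoly K[p]} :=
  [tuple 'X_(src D e) * 'X_(tgt D e) ^+ wt D (tgt D e) | e < q].

Definition toric_ideal (K : fieldType) p q (D : wograph p q)
    (f : {mpoly K[q]}) : Prop :=
  f \mPo edge_images K D = 0.

Definition principal_ideal (R : comNzRingType) (f g : R) : Prop :=
  exists h, g = h * f.

Definition pos_exp q (b : 'rV[int]_q) : 'X_{1..q} :=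
  [multinom if (0 < b 0 i)%R then absz (b 0 i)%R else 0 | i < q].

Definition neg_exp q (b : 'rV[int]_q) : 'X_{1..q} :=
  [multinom if (b 0 i < 0)%R then absz (b 0 i)%R else 0 | i < q].

Definition binom_of (K : fieldType) q (b : 'rV[int]_q) : {mpoly K[q]} :=
  'X_[pos_exp b] - 'X_[neg_exp b].

Definition nz_toric_binom (K : fieldType) p q (D : wograph p q)
    (u v : 'X_{1..q}) : Prop :=
  'X_[u] - 'X_[v] != 0 :> {mpoly K[q]} /\
  @toric_ideal K p q D ('X_[u] - 'X_[v]).

(* The order [<=] on multinomials in scope [MM] is componentwise, that is,
   divisibility of monomials. *)
Definition primitive_binom (K : fieldType) p q (D : wograph p q)
    (u v : 'X_{1..q}) : Prop :=
  nz_toric_binom K D u v /\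
  forall u' v' : 'X_{1..q}, nz_toric_binom K D u' v' ->
    (u' <= u)%MM -> (v' <= v)%MM ->
    'X_[u'] - 'X_[v'] = 'X_[u] - 'X_[v] :> {mpoly K[q]}.

Definition del_minor m (A : 'M[int]_m) (i j : 'I_m) : int :=
  \det (row' i (col' j A)).

Definition minor_gcd m (A : 'M[int]_m.+1) : int :=
  \big[gcdz/0]_(i < m.+1) del_minor A ord0 i.

(* Indices start at 0 here, so the sign (-1)^(i+1) of the usual 1-based
   numbering becomes (-1)^i.  The integer division is exact: see
   [cycle_vecE]. *)
Definition cycle_vec m (A : 'M[int]_m.+1) : 'rV[int]_m.+1 :=
  \row_i (((-1) ^+ i * del_minor A ord0 i) %/ minor_gcd A)%Z.

Lemma cycle_vecE m (A : 'M[int]_m.+1) i :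
  minor_gcd A * cycle_vec A 0 i = (-1) ^+ i * del_minor A ord0 i.
Proof.
have dvd_gcd (F : 'I_m.+1 -> int) (s : seq 'I_m.+1) :
  i \in s -> (\big[gcdz/0]_(j <- s) F j %| F i)%Z.
  elim: s => // j s IHs; rewrite inE big_cons => /predU1P[<- | /IHs].
    exact: dvdz_gcdl.
  exact/dvdz_trans/dvdz_gcdr.
by rewrite mxE mulrC divzK // dvdz_mull // dvd_gcd ?mem_index_enum.
Qed.

(* Main.v *)
(* A binomial x^u - x^v lies in the toric ideal iff A(u - v) = 0, where A is the
   incidence matrix.  If the kernel of A is Z c, then u - v = k c, which makes
   x^u - x^v a multiple of f_c, and k = 1 whenever x^u - x^v divides f_c
   termwise, so f_c is primitive.

   For a balanced cycle, the vector of cofactors along row 0 lies in the kernel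
   because A adj(A) = det(A) I = 0; it is nonzero since deleting row 0 and
   column 0 leaves a triangular matrix with positive diagonal.  Any kernel vector
   b is proportional to it, c_0 b = b_0 c, and a Bezout relation
   sum_i a_i c_i = 1 turns this into b = (sum_i a_i b_i) c. *)
Require Import Defs.
From HB Require Import structures.
From mathcomp Require Import all_boot all_order all_algebra.
From mathcomp Require Import mpoly zify.

Set Implicit Arguments.
Unset Strict Implicit.
Unset Printing Implicit Defensive.

Import Order.TTheory GRing.Theory Num.Theory.
Local Open Scope ring_scope.


(** * Toric binomials and the kernel of the incidence matrix *)

Definition exp_diff q (u v : 'X_{1..q}) : 'rV[int]_q :=
  \row_i ((u i)%:Z - (v i)%:Z).

(** Exponent of the image of ['X_[u]], kept in naturals so that it can index a monomial. *)
Definition edge_exp p q (D : wograph p q) (u : 'X_{1..q}) : 'X_{1..p} :=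
  (\sum_(e < q) (U_(src D e) + U_(tgt D e) *+ wt D (tgt D e)) *+ u e)%MM.

Lemma edge_expE p q (D : wograph p q) u x :
  (edge_exp D u x)%:Z = \sum_e incidence_mx D x e * (u e)%:Z.
Proof.
rewrite mnm_sumE -natz natr_sum; apply: eq_bigr => e _.
rewrite mulmnE mnmDE mulmnE !mnm1E mxE natz PoszM; congr (_ * _).
have := src_neq_tgt D e; rewrite ![_ == x]eq_sym.
case: (eqVneq x (src D e)) => [-> /negPf->//|_ _].
by case: eqP => [->|_]; rewrite add0n ?mul1n.
Qed.

Lemma edge_exp_eqP p q (D : wograph p q) u v :
  edge_exp D u = edge_exp D v <-> incidence_mx D *m (exp_diff u v)^T = 0.
Proof.
have E x : (incidence_mx D *m (exp_diff u v)^T) x 0 =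
    (edge_exp D u x)%:Z - (edge_exp D v x)%:Z.
  rewrite !edge_expE -sumrB mxE; apply: eq_bigr => e _.
  by rewrite !mxE mulrBr.
split=> [eq_uv|A0]; first by apply/matrixP=> x j; rewrite ord1 E eq_uv subrr mxE.
apply/mnmP=> x; have /eqP := E x.
by rewrite A0 mxE eq_sym subr_eq0 => /eqP [].
Qed.

Lemma comp_edge_images (K : fieldType) p q (D : wograph p q) u :
  'X_[u] \mPo edge_images K D = 'X_[edge_exp D u].
Proof.
rewrite comp_mpolyX -mprodXnE; apply: eq_bigr => e _.
by rewrite tnth_mktuple mpolyXD -mpolyXn.
Qed.

Lemma mpolyX_inj (R : nzRingType) n : injective (fun u => 'X_[u] : {mpoly R[n]}).
Proof.
move=> u v /(congr1 (mcoeff u)); rewrite !mcoeffX eqxx eq_sym.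
by case: eqP => // _ /eqP; rewrite oner_eq0.
Qed.

Lemma toric_binomP (K : fieldType) p q (D : wograph p q) u v :
  toric_ideal D ('X_[u] - 'X_[v] : {mpoly K[q]}) <->
  incidence_mx D *m (exp_diff u v)^T = 0.
Proof.
rewrite -edge_exp_eqP /toric_ideal comp_mpolyB !comp_edge_images.
by split=> [/subr0_eq/mpolyX_inj|->] //; rewrite subrr.
Qed.

Lemma exp_diff_pos_neg q (c : 'rV[int]_q) :
  exp_diff (pos_exp c) (neg_exp c) = c.
Proof. by apply/rowP=> i; rewrite mxE !mnmE; case: ltgtP => ?; lia. Qed.

Lemma exp_diffC q (u v : 'X_{1..q}) : exp_diff v u = - exp_diff u v.
Proof. by apply/rowP=> i; rewrite !mxE opprB. Qed.

(** * Ideal generation and primitivity from a cyclic kernel *)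

Lemma principal_idealN (R : comNzRingType) (f g : R) :
  principal_ideal f g -> principal_ideal f (- g).
Proof. by case=> h ->; exists (- h); rewrite mulNr. Qed.

Lemma principal_ideal_sum (R : comNzRingType) (f : R) (I : Type) (s : seq I)
    (F : I -> R) :
  (forall i, principal_ideal f (F i)) -> principal_ideal f (\sum_(i <- s) F i).
Proof.
move=> fF; elim/big_ind: _ => [|_ _ [g ->] [h ->]|//].
  by exists 0; rewrite mul0r.
by exists (g + h); rewrite mulrDl.
Qed.

(** Up to a common monomial factor the binomial is [x ^+ n - y ^+ n], a multiple of [x - y]; a
    negative [k] swaps [u] and [v]. *)
Lemma mpolyX_diff_principal (K : fieldType) q (c : 'rV[int]_q) u v (k : int) :
  exp_diff u v = k *: c ->
  principal_ideal (binom_of K c) ('X_[u] - 'X_[v]).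
Proof.
suff dvd_nat (n : nat) u1 v1 : exp_diff u1 v1 = n%:Z *: c ->
    principal_ideal (binom_of K c) ('X_[u1] - 'X_[v1]).
  case: k => n; first exact: dvd_nat.
  rewrite NegzE scaleNr => /(congr1 -%R); rewrite opprK -exp_diffC => /dvd_nat.
  by rewrite -opprB => /principal_idealN; rewrite opprK.
move=> /rowP uv; have {}uv i : (u1 i)%:Z - (v1 i)%:Z = n%:Z * c 0 i.
  by have := uv i; rewrite !mxE.
(* The truncated subtraction is exact: where [c] is negative, [u1 >= 0] forces [v1] to be at least
   [n] times its absolute value. *)
have Ev : v1 = ((v1 - neg_exp c *+ n) + neg_exp c *+ n)%MM.
  rewrite submK //; apply/mnm_lepP=> i; rewrite mulmnE mnmE.
  by have := uv i; case: ltgtP => ?; nia.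
have Eu : u1 = ((v1 - neg_exp c *+ n) + pos_exp c *+ n)%MM.
  apply/mnmP=> i; rewrite mnmDE mnmBE !mulmnE !mnmE.
  by have := uv i; case: ltgtP => ?; nia.
rewrite Eu {2}Ev !mpolyXD -!mpolyXn -mulrBr subrXX mulrCA mulrC.
by eexists.
Qed.

(** The sum is the coefficient of ['X_[w]] in the image of [f]. *)
Lemma toric_idealE (K : fieldType) p q (D : wograph p q) (f : {mpoly K[q]}) w :
  toric_ideal D f ->
  \sum_(u <- msupp f | edge_exp D u == w) f@_u = 0.
Proof.
move/(congr1 (mcoeff w)); rewrite {1}[f]mpolyE [_ \mPo _]raddf_sum mcoeff0 => f0.
rewrite -[RHS]f0 raddf_sum big_mkcond /=; apply: eq_bigr => u _.
rewrite comp_mpolyZ comp_edge_images mcoeffZ mcoeffX.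
by case: eqP => _; rewrite ?mulr1 ?mulr0.
Qed.

(* Replacing each monomial of [f] by a fixed monomial [r w] with the same image
   [w] changes [f] by a sum of binomials of the ideal, and turns [f] into [0]
   since the coefficients over each [w] cancel. *)
Lemma toric_ideal_principal (K : fieldType) p q (D : wograph p q)
    (c : 'rV[int]_q) :
  (forall b : 'rV[int]_q,
     incidence_mx D *m b^T = 0 <-> exists k : int, b = k *: c) ->
  forall f : {mpoly K[q]},
    toric_ideal D f <-> principal_ideal (binom_of K c) f.
Proof.
move=> kerD f; split=> [f0|[h ->]]; last first.
  have /toric_binomP cD :
      incidence_mx D *m (exp_diff (pos_exp c) (neg_exp c))^T = 0.
    by apply/kerD; exists 1; rewrite exp_diff_pos_neg scale1r.
  by rewrite /toric_ideal rmorphM /= cD mulr0.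
pose ws := [seq edge_exp D u | u <- msupp f].
pose r w := nth 0%MM (msupp f) (index w ws).
have rP u : u \in msupp f -> edge_exp D (r (edge_exp D u)) = edge_exp D u.
  move=> uf; have wu : edge_exp D u \in ws by apply: map_f.
  rewrite -[RHS](nth_index 0%MM wu) (nth_map 0%MM) //.
  by rewrite -(size_map (edge_exp D)) index_mem.
have f_r : \sum_(u <- msupp f) f@_u *: 'X_[r (edge_exp D u)] = 0 :> {mpoly K[q]}.
  (* The inner sum has exactly one term; exchanging the sums then collects the fibre over each
     [w]. *)
  transitivity (\sum_(u <- msupp f) \sum_(w <- undup ws | edge_exp D u == w)
      f@_u *: 'X_[r w] : {mpoly K[q]}).
    apply: eq_big_seq => u uf; rewrite -big_filter.
    have -> : [seq w <- undup ws | edge_exp D u == w] = [:: edge_exp D u].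
      rewrite (@eq_filter _ _ (pred1 (edge_exp D u))) => [|w /=]; last first.
        by rewrite eq_sym.
      by rewrite filter_pred1_uniq ?undup_uniq // mem_undup map_f.
    by rewrite big_seq1.
  rewrite (exchange_big_dep predT) //= big1 // => w _.
  by rewrite -scaler_suml toric_idealE // scale0r.
rewrite -[f]subr0 -f_r {1}[f]mpolyE -sumrB big_seq_cond big_mkcond /=.
apply: principal_ideal_sum => u; rewrite andbT; case: ifP => [/rP ru|_]; last first.
  by exists 0; rewrite mul0r.
have /kerD [k uk] : incidence_mx D *m (exp_diff u (r (edge_exp D u)))^T = 0.
  exact/edge_exp_eqP.
case: (mpolyX_diff_principal K uk) => h Eh.
by exists (f@_u *: h); rewrite -scalerBr Eh scalerAl.
Qed.

Lemma kernel_generator_primitive (K : fieldType) p q (D : wograph p q)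
    (c : 'rV[int]_q) :
  (forall b : 'rV[int]_q,
     incidence_mx D *m b^T = 0 <-> exists k : int, b = k *: c) ->
  c != 0 -> primitive_binom K D (pos_exp c) (neg_exp c).
Proof.
move=> kerD /rV0Pn[i0 ci0]; split; [split|].
- rewrite subr_eq0; apply: contraNneq ci0 => /mpolyX_inj /mnmP/(_ i0).
  by rewrite !mnmE; case: ltgtP => ?; lia.
- apply/toric_binomP/kerD; exists 1.
  by rewrite exp_diff_pos_neg scale1r.
move=> u v [uv_neq0 /toric_binomP/kerD[k /rowP uv]] /mnm_lepP u_le /mnm_lepP v_le.
have {}uv i : (u i)%:Z - (v i)%:Z = k * c 0 i by have := uv i; rewrite !mxE.
have k_neq0 : k != 0.
  apply: contraNneq uv_neq0 => k0; rewrite subr_eq0; apply/eqP; congr 'X_[_].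
  by apply/mnmP=> i; have := uv i; rewrite k0 mul0r; lia.
(* At [i0] the bounds put [u - v] between 0 and [c], so [k] is 0 or 1. *)
have k1 : k = 1.
  have := u_le i0; have := v_le i0; have := uv i0; rewrite !mnmE.
  by case: ltgtP ci0 => // ? _; nia.
have Eu : u = pos_exp c.
  apply/mnmP=> i; have := u_le i; have := v_le i; have := uv i.
  by rewrite k1 !mnmE; case: ltgtP => ?; lia.
have Ev : v = neg_exp c.
  apply/mnmP=> i; have := u_le i; have := v_le i; have := uv i.
  by rewrite k1 !mnmE; case: ltgtP => ?; lia.
by rewrite Eu Ev.
Qed.

Lemma big_gcdz_Bezout (I : eqType) (s : seq I) (F : I -> int) :
  uniq s ->
  exists a : I -> int, \big[gcdz/0]_(i <- s) F i = \sum_(i <- s) a i * F i.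
Proof.
elim: s => [_|i s IHs /= /andP[i_s /IHs[a Ea]]].
  by exists (fun=> 0); rewrite !big_nil.
case: (Bezoutz (F i) (\sum_(j <- s) a j * F j)) => x [y xy].
(* As [i] is not in [s], its new coefficient does not disturb the tail. *)
exists (fun j => if j == i then x else y * a j).
rewrite !big_cons eqxx Ea -xy mulr_sumr; congr (_ + _).
by apply: eq_big_seq => j js; case: eqP js i_s => [->->|_ _ _] //; rewrite mulrA.
Qed.

(** * The kernel of a balanced cycle *)

Section Cycle.
Variables (m : nat) (C : wograph m.+1 m.+1).
Hypothesis C_cycle : is_cycle C.
Let A := incidence_mx C.

Lemma cycle_incidence_gt0 x e : (0 < A x e) = (x == e) || (x == ordS e).
Proof.
have [_ /(_ e)/setP/(_ x)] := C_cycle; rewrite !inE /A mxE => <-.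
by case: eqP => //= _; case: eqP => // _; rewrite ltz_nat wt_gt0.
Qed.

Lemma cycle_incidence_eq0 x e : x != e -> x != ordS e -> A x e = 0.
Proof.
have [_ /(_ e)/setP/(_ x)] := C_cycle; rewrite !inE /A mxE.
by move=> E /negPf xe /negPf xSe; move: E; rewrite xe xSe; do 2!case: eqP.
Qed.

Lemma cycle_del_minor00_gt0 : 0 < del_minor A ord0 ord0.
Proof.
rewrite /del_minor det_trig; last first.
  apply/is_trig_mxP=> i j ij; rewrite 2!mxE; apply: cycle_incidence_eq0.
    by rewrite (inj_eq lift_inj) -val_eqE neq_ltn ij.
  rewrite -val_eqE /= /bump /= !add1n.
  (* The last edge wraps around to vertex 0, whose row is deleted. *)
  case: (ltngtP j.+2 m.+1) => [jm|jm|->]; last by rewrite modnn.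
    by rewrite modn_small // eqSS neq_ltn ltnS (ltnW ij).
  by have := ltn_ord j; lia.
by apply: prodr_gt0 => i _; rewrite 2!mxE cycle_incidence_gt0 eqxx.
Qed.

(** Vertex [j] meets only the edges [i] and [j]. *)
Lemma ker_cycleS (b : 'rV[int]_m.+1) (i j : 'I_m.+1) :
  A *m b^T = 0 -> j = i.+1 :> nat -> A j i * b 0 i + A j j * b 0 j = 0.
Proof.
move=> /matrixP/(_ j 0) Ab ji; rewrite mxE [RHS]mxE in Ab.
rewrite -[RHS]Ab (bigD1 i) //= (bigD1 j) /=; last first.
  by rewrite -val_eqE /= ji gtn_eqF.
rewrite 2![b^T _ _]mxE big1 ?addr0 // => k /andP[ki kj].
rewrite cycle_incidence_eq0 ?mul0r 1?eq_sym // -val_eqE /= ji.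
apply: contra_neq ki => kE; apply: val_inj.
have := ltn_ord k; rewrite leq_eqVlt => /predU1P[kE'|km].
  by move: kE; rewrite kE' modnn.
by move: kE; rewrite modn_small // => -[].
Qed.

(* Row [i + 1] determines the entry of index [i + 1] from that of index [i], so
   the kernel has rank at most one. *)
Lemma ker_cycle_prop (b c : 'rV[int]_m.+1) :
  A *m b^T = 0 -> A *m c^T = 0 -> c 0 0 *: b = b 0 0 *: c.
Proof.
move=> Ab Ac; apply/rowP=> -[i im]; rewrite !mxE.
elim: i im => [|i IHi] im.
  by rewrite (_ : Ordinal im = 0) 1?mulrC //; apply: val_inj.
set j := Ordinal im; pose i' := Ordinal (ltnW im).
have /addr0_eq Eb := ker_cycleS (i := i') (j := j) Ab erefl.
have /addr0_eq Ec := ker_cycleS (i := i') (j := j) Ac erefl.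
have A_neq0 : A j j != 0 by rewrite gt_eqF // cycle_incidence_gt0 eqxx.
(* After scaling by [A j j], the claim is the one at index [i] times [- A j i]. *)
apply: (mulfI A_neq0); rewrite mulrCA -Eb [RHS]mulrCA -Ec !mulrN.
by rewrite mulrCA IHi mulrCA.
Qed.

Lemma cycle_minor_gcd_neq0 : minor_gcd A != 0.
Proof.
have := cycle_del_minor00_gt0; apply: contraL => /eqP d0.
by have := cycle_vecE A 0; rewrite d0 mul0r expr0 mul1r => <-.
Qed.

Lemma cycle_vec0_neq0 : cycle_vec A 0 0 != 0.
Proof.
have := cycle_vecE A 0; rewrite expr0 mul1r.
have := cycle_del_minor00_gt0; case: eqP => // ->; rewrite mulr0 => + E.
by rewrite -E.
Qed.

Hypothesis C_bal : balanced C.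

Lemma ker_cycle_vec : A *m (cycle_vec A)^T = 0.
Proof.
apply/(scalemx_inj cycle_minor_gcd_neq0); rewrite scaler0 scalemxAr.
have -> : minor_gcd A *: (cycle_vec A)^T = col 0 (\adj A).
  apply/colP=> i; rewrite [LHS]mxE [(_^T) _ _]mxE cycle_vecE !mxE /cofactor.
  by rewrite add0n.
by rewrite colE mulmxA mul_mx_adj C_bal mul_scalar_mx scale0r.
Qed.

Lemma ker_cycleP (b : 'rV[int]_m.+1) :
  A *m b^T = 0 <-> exists k : int, b = k *: cycle_vec A.
Proof.
set c := cycle_vec A; have Ac := ker_cycle_vec.
split=> [Ab|[k ->]]; last by rewrite linearZ -scalemxAr Ac scaler0.
have cb := ker_cycle_prop Ab Ac.
have [a Ea] := big_gcdz_Bezout (del_minor A ord0) (index_enum_uniq 'I_m.+1).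
pose k := \sum_i a i * (-1) ^+ i * b 0 i.
(* This is the Bezout relation of the minors divided by their gcd; the signs cancel those in [c]. *)
have c1 : \sum_i a i * (-1) ^+ i * c 0 i = 1.
  apply: (mulfI cycle_minor_gcd_neq0); rewrite mulr1 {2}/minor_gcd Ea mulr_sumr.
  apply: eq_bigr => i _; rewrite mulrCA cycle_vecE.
  by rewrite mulrA -[_ * _ * (-1) ^+ i]mulrA -expr2 sqrr_sign mulr1.
(* By [cb] it remains to show [b 0 0 = c 0 0 * k]: expand [b 0 0 * 1] by [c1] and use [cb] in each
   entry. *)
exists k; apply: (scalemx_inj cycle_vec0_neq0).
rewrite -/c cb scalerA; congr (_ *: c).
rewrite -[LHS]mulr1 -c1 !mulr_sumr; apply: eq_bigr => i _.
by have /rowP/(_ i) := cb; rewrite !mxE mulrCA => <-; rewrite mulrCA.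
Qed.

End Cycle.

Theorem theorem4p4 (K : fieldType) (m n : nat) (m1E : m.+1 = (2 * n)%N)
    (C : wograph m.+1 m.+1) (C_cycle : is_cycle C) (C_bal : balanced C) :
  let c : 'rV[int]_m.+1 := cycle_vec (incidence_mx C) in
  primitive_binom K C (pos_exp c) (neg_exp c) /\
  (forall g : {mpoly K[m.+1]},
     toric_ideal C g <-> principal_ideal (binom_of K c) g).
Proof.
move=> c; have kerC : forall b, _ := ker_cycleP C_cycle C_bal.
split; last exact: toric_ideal_principal.
apply: kernel_generator_primitive => //.
by apply/rV0Pn; exists 0; apply: cycle_vec0_neq0.
Qed.
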